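(* (a) If two finite $T_0$-spaces $X$ and $Y$ are homotopy equivalent, then their associated simplicial complexes $\mathcal{K}(X)$ and $\mathcal{K}(Y)$ have the same strong homotopy type. (b) If two finite simplicial complexes $K$ and $L$ have the same strong homotopy type, then the associated finite spaces $\mathcal{X}(K)$ and $\mathcal{X}(L)$ are homotopy equivalent.
   Context: All simplicial complexes are finite (simplices are nonempty finite sets of vertices). For a vertex $v$ of a complex $K$, the link $\mathrm{lk}_K(v)$ is the subcomplex of simplices $\tau\in K$ with $v\notin\tau$ and $\tau\cup\{v\}\in K$, and $K\smallsetminus v$ is the full subcomplex of $K$ spanned by the vertices different from $v$. A simplicial cone is a complex $aM$, the join of a (possibly empty) complex $M$ and a vertex $a$ not in $M$; its simplices are $\{a\}$, the simplices $\tau$ of $M$, and the sets $\{a\}\cup\tau$ with $\tau\in M$. A vertex $v$ of $K$ is dominated if $\mathrm{lk}_K(v)$ is a simplicial cone; in that case there is an elementary strong collapse from $K$ to $K\smallsetminus v$. A strong collapse from $K$ to a subcomplex $L$ is a finite (possibly empty) sequence of elementary strong collapses starting in $K$ and ending in $L$; its inverse is a strong expansion. Two complexes have the same strong homotopy type if there is a sequence of strong collapses and strong expansions that starts in one and ends in the other. Finite $T_0$-spaces are identified with finite posets: $x\le y$ if and only if $x\in U_y$, where $U_y$ is the minimal open set containing $y$ (so the open sets are the down-sets). Homotopy equivalence of finite $T_0$-spaces is the usual topological notion. For a complex $K$, $\mathcal{X}(K)$ is the finite $T_0$-space corresponding to the poset of simplices of $K$ ordered by inclusion. For a finite $T_0$-space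 $X$, $\mathcal{K}(X)$ is the simplicial complex whose simplices are the nonempty chains of the poset $X$. *)

(* Defs.v *)
From HB Require Import structures.
From Stdlib Require Import Relation_Operators.
From mathcomp Require Import all_boot all_order all_algebra.
Set Implicit Arguments. Unset Strict Implicit. Unset Printing Implicit Defensive.
Import Order.TTheory GRing.Theory Num.Theory.

(* Vertices are labelled by a finType T, but not every label need be a vertex:
   v is a vertex of K when [set v] \in K.  Deleting a vertex thus keeps T. *)
Definition is_complex (T : finType) (S : {set {set T}}) : bool :=
  (set0 \notin S) &&
  [forall s in S, forall t : {set T}, (t \subset s) && (t != set0) ==> (t \in S)].

Record complex (T : finType) := Complex {
  simplices :> {set {set T}};
  complexP : is_complex simplices
}.

HB.instance Definition _ (T : finType) := [isSub for @simplices T].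
HB.instance Definition _ (T : finType) := [Finite of complex T by <:].

Section Complexes.
Variable T : finType.
Implicit Types (K L M : complex T) (v a : T) (s t : {set T}).

Lemma is_complexP (S : {set {set T}}) :
  reflect (set0 \notin S /\
           forall s t, s \in S -> t \subset s -> t != set0 -> t \in S)
          (is_complex S).
Proof.
apply: (iffP andP) => -[S0 Sd]; split=> //.
  move=> s t sS ts t0; have /forall_inP/(_ s sS)/forallP/(_ t) := Sd.
  by rewrite ts t0.
apply/forall_inP => s sS; apply/forallP => t; apply/implyP => /andP[ts t0].
exact: Sd sS ts t0.
Qed.

Lemma complex0 K : set0 \notin simplices K.
Proof. by case/is_complexP: (complexP K). Qed.

Lemma complexS K s t :
  s \in simplices K -> t \subset s -> t != set0 -> t \in simplices K.
Proof. by case/is_complexP: (complexP K) => _; apply. Qed.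

Definition is_vertex K v : bool := [set v] \in simplices K.

Definition link_set K v : {set {set T}} :=
  [set t in simplices K | (v \notin t) && (v |: t \in simplices K)].

Fact link_subproof K v : is_complex (link_set K v).
Proof.
apply/is_complexP; split; first by rewrite inE (negPf (complex0 K)).
move=> s t; rewrite !inE => /and3P[sK vs vsK] ts t0.
rewrite (complexS sK ts t0) (contra (subsetP ts v) vs) /=.
by apply: complexS vsK _ _; [exact: setUS | apply/set0Pn; exists v; rewrite setU11].
Qed.

Definition link K v : complex T := Complex (link_subproof K v).

Definition deletion_set K v : {set {set T}} :=
  [set t in simplices K | v \notin t].

Fact deletion_subproof K v : is_complex (deletion_set K v).
Proof.
apply/is_complexP; split; first by rewrite inE (negPf (complex0 K)).
move=> s t; rewrite !inE => /andP[sK vs] ts t0.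
by rewrite (complexS sK ts t0) (contra (subsetP ts v) vs).
Qed.

Definition deletion K v : complex T := Complex (deletion_subproof K v).

Definition cone_set a M : {set {set T}} :=
  [set a] |: simplices M :|: [set a |: t | t in simplices M].

Fact cone_subproof a M : is_complex (cone_set a M).
Proof.
apply/is_complexP; split.
  rewrite !inE (negPf (complex0 M)) orbF negb_or; apply/andP; split.
    by apply/eqP => /setP/(_ a); rewrite !inE eqxx.
  by apply/negP => /imsetP[t _ /setP/(_ a)]; rewrite !inE eqxx.
move=> s t sC ts t0.
have [ta0|ta0] := boolP (t :\ a == set0).
  suff -> : t = [set a] by rewrite !inE eqxx.
  by apply/eqP; move: ta0; rewrite setD_eq0 subset1 (negPf t0) orbF.
have taM : t :\ a \in simplices M.
  case/setUP: sC => [/setU1P[sa|sM]|/imsetP[u uM su]].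
  - by move: ts; rewrite sa -setD_eq0 (negPf ta0).
  - by apply: complexS sM _ ta0; exact: subset_trans (subsetDl _ _) ts.
  - by apply: complexS uM _ ta0; rewrite subDset -su.
have [at_|at_] := boolP (a \in t).
  by apply/setUP; right; apply/imsetP; exists (t :\ a); rewrite ?setD1K.
have -> : t = t :\ a.
  by apply/setP => x; rewrite !inE; case: eqP => // ->; rewrite (negPf at_).
by rewrite !inE taM orbT.
Qed.

Definition cone a M : complex T := Complex (cone_subproof a M).

Definition is_simplicial_cone L : Prop :=
  exists a M, ~~ is_vertex M a /\ L = cone a M.

Definition dominated K v : Prop :=
  is_vertex K v /\ is_simplicial_cone (link K v).

Definition elementary_strong_collapse K L : Prop :=
  exists v, dominated K v /\ L = deletion K v.

Definition strong_collapse : complex T -> complex T -> Prop :=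
  clos_refl_trans _ elementary_strong_collapse.

Definition strong_expansion K L : Prop := strong_collapse L K.

Definition strong_deformation : complex T -> complex T -> Prop :=
  clos_refl_trans _ (fun K L => strong_collapse K L \/ strong_expansion K L).

End Complexes.

Section Relabelling.
Variables (T W : finType) (f : T -> W).

Definition relabel_set (K : complex T) : {set {set W}} :=
  [set f @: s | s : {set T} in simplices K].

Fact relabel_subproof K : is_complex (relabel_set K).
Proof.
apply/is_complexP; split.
  apply/negP => /imsetP[s sK] /esym/eqP; rewrite imset_eq0 => /eqP s0.
  by have := complex0 K; rewrite -s0 sK.
move=> _ t /imsetP[s sK ->] ts t0; apply/imsetP.
exists (s :&: f @^-1: t).
  apply: complexS sK (subsetIl _ _) _.
  have /set0Pn[y yt] := t0; have /imsetP[x xs yx] := subsetP ts y yt.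
  by apply/set0Pn; exists x; rewrite !inE xs -yx.
apply/setP => y; apply/idP/imsetP => [yt|[x + ->]]; last by rewrite !inE => /andP[].
have /imsetP[x xs yx] := subsetP ts y yt.
by exists x => //; rewrite !inE xs -yx.
Qed.

Definition relabel (K : complex T) : complex W := Complex (relabel_subproof K).

End Relabelling.

(* Expansions may introduce new vertices, and K and L may be labelled by
   different types, so the sequence takes place over some finite set W of
   labels containing those of K and L.  The choice of the injections is
   immaterial: a vertex v can be renamed to a fresh v' by an expansion adding
   v' dominated by v, with link v * lk(v), followed by the deletion of v. *)
Definition same_strong_homotopy_type (T S : finType)
    (K : complex T) (L : complex S) : Prop :=
  exists (W : finType) (i : T -> W) (j : S -> W),
    [/\ injective i, injective j & strong_deformation (relabel i K) (relabel j L)].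

From mathcomp Require Import all_classical all_reals all_analysis.
Import numFieldNormedType.Exports.
Local Open Scope classical_set_scope.
Local Open Scope ring_scope.

#[short(type="finTopologicalType")]
HB.structure Definition FinTopological := {T of Finite T & Topological T}.

Section Homotopy.
Variable R : realType.

Definition homotopic (X Y : topologicalType) (f g : X -> Y) : Prop :=
  exists H : X * R -> Y,
    [/\ {within [set: X] `*` `[0, 1], continuous H},
        forall x, H (x, 0) = f x & forall x, H (x, 1) = g x].

Definition homotopy_equivalent (X Y : topologicalType) : Prop :=
  exists (f : X -> Y) (g : Y -> X),
    [/\ continuous f, continuous g, homotopic (g \o f) id & homotopic (f \o g) id].

End Homotopy.

Section OrderComplex.
Variable X : finTopologicalType.

Definition minimal_open (y : X) : set X :=
  \bigcap_(U in [set U : set X | open U /\ U y]) U.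

Definition spec_le (x y : X) : bool := `[< minimal_open y x >].

Definition order_complex_set : {set {set X}} :=
  [set s : {set X} | (s != finset.set0) &&
    [forall x in s, forall y in s, spec_le x y || spec_le y x]]%SET.

Fact order_complex_subproof : is_complex order_complex_set.
Proof.
apply/is_complexP; split; first by rewrite inE eqxx.
move=> s t; rewrite !inE => /andP[_ /forall_inP sC] ts -> /=.
apply/forall_inP => x /(fintype.subsetP ts) xs.
apply/forall_inP => y /(fintype.subsetP ts) ys.
by have /forall_inP := sC x xs; apply.
Qed.

Definition order_complex : complex X := Complex order_complex_subproof.

End OrderComplex.

Section FaceSpace.
Variables (T : finType) (K : complex T).

Definition face_space : Type := {s : {set T} | s \in simplices K}.

HB.instance Definition _ := Finite.on face_space.

Definition face_le (s t : face_space) : bool := val s \subset val t.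

Definition face_open (U : set face_space) : Prop :=
  forall s t, face_le s t -> U t -> U s.

Fact face_openT : face_open setT. Proof. by []. Qed.

Fact face_openI : setI_closed face_open.
Proof. by move=> A B oA oB s t st [/(oA _ _ st) ? /(oB _ _ st) ?]. Qed.

Fact face_open_bigU (I : Type) (f : I -> set face_space) :
  (forall i, face_open (f i)) -> face_open (\bigcup_i f i).
Proof. by move=> of_ s t st [i _ /(of_ i _ _ st) ?]; exists i. Qed.

HB.instance Definition _ := @isOpenTopological.Build face_space
  face_open face_openT face_openI face_open_bigU.

Lemma face_openE : @open face_space = face_open.
Proof. by []. Qed.

Lemma spec_leE (s t : face_space) : spec_le s t = face_le s t.
Proof.
apply/asboolP/idP => [/(_ [set u | face_le u t])|st U /= [oU Ut]]; last first.
  by move: oU; rewrite face_openE => /(_ _ _ st); apply.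
apply; split; last exact: fintype.subxx.
by rewrite face_openE => u w uw wt; exact: fintype.subset_trans uw wt.
Qed.

Lemma face_space_kolmogorov : kolmogorov_space face_space.
Proof.
move=> s t st.
have lower_nbhs (u : face_space) : nbhs u [set w | face_le w u].
  apply: open_nbhs_nbhs; split; last exact: fintype.subxx.
  by rewrite face_openE => w z wz zu; exact: fintype.subset_trans wz zu.
have [le_st|nle_st] := boolP (face_le s t).
  exists [set w | face_le w s]; left; split; first exact/mem_set.
  rewrite in_setE /= => le_ts; move/eqP: st; apply; apply/val_inj/eqP.
  by rewrite finset.eqEsubset; apply/andP.
exists [set w | face_le w t]; right; split; first exact/mem_set.
by rewrite in_setE /=; apply/negP.
Qed.

End FaceSpace.

(* Main.v *)
(* A homotopy between maps of finite spaces is the same thing as a fence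
   f <= f1 >= f2 <= ... of order-preserving maps.

   (a) Removing beat points one by one turns X and Y into subspaces without
   beat points, on which a map joined to the identity by a fence is the
   identity; so homotopy equivalent spaces have isomorphic cores.  A beat point
   of a poset is a dominated vertex of its order complex, and isomorphic
   complexes are related by doubling every vertex of one of them.

   (b) If v is dominated by a, the maps s |-> s, s |-> s + a and
   s |-> s + a - v (the last two applied only when v is in s) form a fence, so
   the face poset of K retracts by deformation onto that of K - v. *)
Require Import Defs.
From Stdlib Require Import Relation_Operators.
From mathcomp Require Import all_boot all_order all_algebra.

Set Implicit Arguments.
Unset Strict Implicit.
Unset Printing Implicit Defensive.

(** * Strong collapses *)

Section Domination.
Variable T : finType.
Implicit Types (K : complex T) (v a : T) (s : {set T}).

(** The cone condition on the link expressed in [K] alone: the apex [a] can be added to every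
    simplex through [v]. No base of the cone has to be named. *)
Definition dominated_by K v a : Prop :=
  [/\ is_vertex K v, a != v & forall s, s \in simplices K -> v \in s ->
      a |: s \in simplices K].

Lemma dominatedP K v : dominated K v <-> exists a, dominated_by K v a.
Proof.
split=> [[Kv [a [M [Ma lkE]]]]|[a [Kv av aK]]].
  have lk_mem s : (s \in link_set K v) = (s \in cone_set a M).
    by rewrite -[link_set K v]/(simplices (link K v)) lkE.
  have : [set a] \in link_set K v by rewrite lk_mem !inE eqxx.
  rewrite !inE => /and3P[_ va avK].
  exists a; split=> // [|s sK vs]; first by rewrite eq_sym.
  (* The link contains [s :\ v] only when it is nonempty, so [s = [set v]] is treated apart. *)
  have [s0|sD0] := eqVneq (s :\ v) set0.
    have -> : s = [set v] by rewrite -(setD1K vs) s0 setU0.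
    by rewrite setUC.
  have : s :\ v \in link_set K v.
    rewrite inE (complexS sK (subsetDl _ _) sD0) setD11 /=.
    by rewrite setD1K.
  rewrite lk_mem => svC.
  have : a |: (s :\ v) \in link_set K v.
    rewrite lk_mem; case/setUP: svC => [/setU1P[->|sM]|/imsetP[u uM ->]].
    - by rewrite setUid !inE eqxx.
    - by apply/setUP; right; apply/imsetP; exists (s :\ v).
    - by rewrite setUA setUid; apply/setUP; right; apply/imsetP; exists u.
  by rewrite inE => /and3P[_ _]; rewrite setUCA setD1K.
(* The base of the cone consists of the simplices of the link that miss [a]. *)
split=> //; exists a, (deletion (link K v) a); split.
  by rewrite /is_vertex /= !inE eqxx andbF.
have aM s : s \in link_set K v -> a |: s \in link_set K v.
  rewrite !inE => /and3P[sK vs vsK].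
  have avsK := aK _ vsK (setU11 _ _).
  rewrite eq_sym (negPf av) (negPf vs) setUCA avsK !andbT.
  apply: complexS avsK _ _; first by apply: setUS; exact: subsetUr.
  by apply/set0Pn; exists a; exact: setU11.
apply/val_inj/setP => s /=; apply/idP/idP => [slk|].
  have s0 : s != set0.
    by apply: contraTneq slk => ->; exact: (complex0 (link K v)).
  have [as_|as_] := boolP (a \in s); last first.
    by apply/setUP; left; apply/setU1P; right; rewrite inE as_ andbT.
  have [sa|sa0] := eqVneq (s :\ a) set0.
    by rewrite -(setD1K as_) sa setU0 !inE eqxx.
  apply/setUP; right; apply/imsetP; exists (s :\ a); last by rewrite setD1K.
  rewrite inE setD11 andbT.
  exact: (@complexS _ (link K v) _ _ slk (subsetDl _ _) sa0).
case/setUP=> [/setU1P[->|]|/imsetP[u]].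
- rewrite !inE eq_sym av setUC aK ?set11 // !andbT.
  apply: (complexS (aK _ Kv (set11 _))); first exact: subsetUl.
  by apply/set0Pn; exists a; exact: set11.
- by rewrite inE => /andP[].
- by rewrite inE => /andP[ulk _] ->; exact: aM.
Qed.

Lemma dominated_by_collapse K v a :
  dominated_by K v a -> strong_collapse K (deletion K v).
Proof.
move=> dom; apply: rt_step; exists v; split=> //.
by apply/dominatedP; exists a.
Qed.

End Domination.

Lemma relabel_strong_collapse (T W : finType) (f : T -> W) (K L : complex T) :
  injective f -> strong_collapse K L ->
  strong_collapse (relabel f K) (relabel f L).
Proof.
move=> f_inj; elim=> {K L} [K _ [v [+ ->]]|K|K M L _ KM _ ML]; last 2 first.
- exact: rt_refl.
- exact: rt_trans KM ML.
move=> /dominatedP[a [Kv av aK]].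
have -> : relabel f (deletion K v) = deletion (relabel f K) (f v).
  apply/val_inj/setP => t /=; apply/imsetP/idP => [[s + ->]|].
    rewrite !inE => /andP[sK vs]; rewrite (mem_imset _ _ f_inj) vs andbT.
    exact: imset_f.
  rewrite inE => /andP[/imsetP[s sK ->]]; rewrite (mem_imset _ _ f_inj) => vs.
  by exists s; rewrite // inE sK.
apply: (@dominated_by_collapse _ _ _ (f a)); split=> [||t].
- by apply/imsetP; exists [set v]; rewrite ?imset_set1.
- by rewrite (inj_eq f_inj).
- move=> /imsetP[s sK ->]; rewrite (mem_imset _ _ f_inj) => vs.
  by rewrite -imsetU1; apply/imset_f/aK.
Qed.

(** * Pullbacks of complexes along maps of labels *)

Section Pullback.
Variables (W T : finType) (p : W -> T) (K : complex T).
Implicit Types (D E : {set W}) (s : {set W}).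

(** Labels of [D] with the same image under [p] act as copies of one vertex; for [p = id] this is
    the full subcomplex on [D]. *)
Definition pullback_set D : {set {set W}} :=
  [set s : {set W} | (s \subset D) && (p @: s \in simplices K)].

Fact pullback_subproof D : is_complex (pullback_set D).
Proof.
apply/is_complexP; split; first by rewrite inE imset0 (negPf (complex0 K)) andbF.
move=> s t; rewrite !inE => /andP[sD sK] ts t0.
rewrite (subset_trans ts sD) /=; apply: complexS sK (imsetS p ts) _.
by rewrite imset_eq0.
Qed.

Definition pullback D : complex W := Complex (pullback_subproof D).

Lemma pullbackD1 D w : pullback (D :\ w) = deletion (pullback D) w.
Proof.
apply/val_inj/setP => s /=; rewrite !inE subsetD1 -!andbA.
by congr (_ && _); rewrite andbC.
Qed.

(** Adding [w'] to a set that contains [w] leaves its image under [p] unchanged, so [w'] dominates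
    [w]. *)
Lemma pullback_del D w w' : w' \in D -> w' != w -> p w' = p w ->
  strong_collapse (pullback D) (pullback (D :\ w)).
Proof.
move=> w'D w'w pw.
rewrite pullbackD1; have [vw|nvw] := boolP (is_vertex (pullback D) w).
  apply: (@dominated_by_collapse _ _ _ w'); split=> // s; rewrite !inE.
  move=> /andP[sD sK] ws; rewrite subUset sub1set w'D sD imsetU1 pw.
  by rewrite (setUidPr _) // sub1set imset_f.
(* If [w] is not a vertex, its deletion changes nothing and the empty collapse suffices. *)
suff -> : deletion (pullback D) w = pullback D by exact: rt_refl.
apply/val_inj/setP => s; rewrite /= inE andb_idr // => sD.
apply: contra nvw => ws; apply: (complexS sD); first by rewrite sub1set.
by apply/set0Pn; exists w; rewrite set11.
Qed.

(** Labels outside [E] go one at a time; the copy that dominates each of them lies in [E] and so is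
    never removed. *)
Lemma pullback_shrink D E : E \subset D ->
    (forall w, w \in D -> exists2 w', w' \in E & p w' = p w) ->
  strong_collapse (pullback D) (pullback E).
Proof.
have [n] := ubnP #|D|; elim: n D => // n IHn D ltDn ED pE.
have [DE|] := boolP (D \subset E).
  have -> : D = E by apply/eqP; rewrite eqEsubset DE.
  exact: rt_refl.
case/subsetPn=> w wD wE; have [w' w'E pw] := pE w wD.
have w'w : w' != w by apply: contraNneq wE => <-.
apply: rt_trans (pullback_del (subsetP ED _ w'E) w'w pw) _.
apply: IHn => [||u /setD1P[_ /pE]//]; last by rewrite subsetD1 ED.
by move: ltDn; rewrite (cardsD1 w D) wD ltnS.
Qed.

End Pullback.

(* In the pullback of [K] along [T + S -> T] every vertex of [K] is doubled;
   deleting the copies of one kind or of the other gives [K] or [L]. *)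
Lemma iso_strong_deformation (T S : finType) (K : complex T) (L : complex S)
    (f : T -> S) (g : S -> T) :
    (forall s : {set T}, s \in simplices K -> f @: s \in simplices L) ->
    (forall t : {set S}, t \in simplices L -> g @: t \in simplices K) ->
    {in is_vertex K, cancel f g} -> {in is_vertex L, cancel g f} ->
  strong_deformation (relabel (inl : T -> T + S) K)
                     (relabel (inr : S -> T + S) L).
Proof.
move=> fKL gLK fK gK.
have vertexK (U : finType) (M : complex U) (s : {set U}) x :
    s \in simplices M -> x \in s -> is_vertex M x.
  move=> sM xs; apply: complexS sM _ _; rewrite ?sub1set //.
  by apply/set0Pn; exists x; rewrite set11.
have fV x : is_vertex K x -> is_vertex L (f x).
  by move=> /fKL; rewrite imset_set1.
have gV y : is_vertex L y -> is_vertex K (g y).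
  by move=> /gLK; rewrite imset_set1.
(* Labels from [S] pass through [g], so that both complexes become pullbacks of the same [K]. *)
pose p (w : T + S) := match w with inl x => x | inr y => g y end.
(* Only vertices are kept, since [f] and [g] are assumed inverse to each other only there. *)
pose VK : {set T + S} := [set inl x | x in is_vertex K].
pose VL : {set T + S} := [set inr y | y in is_vertex L].
have p_inl (s : {set T}) : p @: (inl @: s) = s by rewrite -imset_comp imset_id.
have p_inr (t : {set S}) : p @: (inr @: t) = g @: t by rewrite -imset_comp.
have lift_sub (U W : finType) (h : U -> W) (V : pred U) (s : {set W}) :
    s \subset [set h x | x in V] ->
    exists2 t : {set U}, s = h @: t & {subset t <= V}.
  move=> sV; exists [set x in V | h x \in s].
    apply/setP => w; apply/idP/imsetP => [ws|[x]].
      have /imsetP[x xV wx] := subsetP sV w ws.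
      by exists x; rewrite // !inE -wx ws andbT.
    by rewrite !inE => /andP[_ ?] ->.
  by move=> x; rewrite !inE => /andP[].
have -> : relabel (inl : T -> T + S) K = pullback p K VK.
  apply/val_inj/setP => s /=; rewrite inE; apply/imsetP/andP.
    case=> t tK ->; rewrite p_inl; split=> //.
    by apply: imsetS; apply/subsetP => x xt; apply: vertexK xt.
  by case=> /lift_sub[t -> _]; rewrite p_inl => tK; exists t.
have -> : relabel (inr : S -> T + S) L = pullback p K VL.
  apply/val_inj/setP => s /=; rewrite inE; apply/imsetP/andP.
    case=> t tL ->; rewrite p_inr; split; last exact: gLK.
    by apply: imsetS; apply/subsetP => x xt; apply: vertexK xt.
  case=> /lift_sub[t -> tV]; rewrite p_inr => /fKL gtL; exists t => //.
  suff <- : f @: (g @: t) = t by [].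
  rewrite -imset_comp -[RHS]imset_id; apply: eq_in_imset => x /tV; exact: gK.
apply: (@rt_trans _ _ _ (pullback p K (VK :|: VL))).
  apply: rt_step; right; apply: pullback_shrink; first exact: subsetUl.
  move=> w /setUP[wV|/imsetP[y yL ->]]; first by exists w.
  by exists (inl (g y)) => //; apply: imset_f; exact: gV.
apply: rt_step; left; apply: pullback_shrink; first exact: subsetUr.
move=> w /setUP[/imsetP[x xK ->]|wV]; last by exists w.
exists (inr (f x)); last exact: fK.
by apply: imset_f; exact: fV.
Qed.

From mathcomp Require Import all_classical all_reals all_analysis.
Import numFieldNormedType.Exports.
Import Order.TTheory GRing.Theory Num.Theory.

(** * Finite spaces as posets *)

Local Notation "x ⊑ y" := (spec_le x y) (at level 45, no associativity).

Section Specialization.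
Variable X : finTopologicalType.
Implicit Types x y z : X.

Lemma spec_le_refl x : x ⊑ x.
Proof. by apply/asboolP => U [_]. Qed.

Lemma spec_le_trans y x z : x ⊑ y -> y ⊑ z -> x ⊑ z.
Proof.
move=> /asboolP xy /asboolP yz; apply/asboolP => U [oU Uz].
by apply: xy; split=> //; exact: yz.
Qed.

Lemma spec_leP x y : reflect (forall A, nbhs y A -> A x) (x ⊑ y).
Proof.
rewrite /spec_le; apply: (iffP (asboolP _)) => [xy A|xy U [oU Uy]]; last first.
  by apply: xy; apply: open_nbhs_nbhs.
by rewrite nbhsE => -[U [oU Uy] UA]; apply: UA; apply: xy.
Qed.

(** Each [x] not below [y] is missed by some neighbourhood of [y]; as [X] is finite, the
    intersection of these is still a neighbourhood. *)
Lemma near_spec_le y : (\forall z \near y, z ⊑ y)%classic.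
Proof.
have : (\forall z \near y, forall x, ~~ (x ⊑ y) -> z != x)%classic.
  apply: filter_forall => x.
  have [xy|/spec_leP xy] := boolP (x ⊑ y); first by apply: nearW.
  have /existsNP[A /not_implyP[yA Ax]] := xy.
  by near=> z => _; apply: contra_notN Ax => /eqP <-; near: z.
by apply: filterS => z zy; apply: contraT => /zy; rewrite eqxx.
Unshelve. all: by end_near. Qed.

Lemma spec_le_anti x y : kolmogorov_space X -> x ⊑ y -> y ⊑ x -> x = y.
Proof.
move=> X0 xy yx; apply/eqP; apply: contraT => /X0[A].
rewrite !in_setE => -[[xA Ay]|[yA Ax]]; exfalso.
  by apply: Ay; move/spec_leP: yx; exact.
by apply: Ax; move/spec_leP: xy; exact.
Qed.

(** The points below [y] form its smallest neighbourhood, so converging to [y] means eventually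
    lying below [y]. *)
Lemma cvg_spec_leP (T : Type) (F : set_system T) (f : T -> X) y :
  Filter F -> (f @ F --> y)%classic <-> (\forall z \near F, f z ⊑ y)%classic.
Proof.
move=> FF; split=> [fy|Fy A yA]; first exact: fy (near_spec_le y).
by apply: filterS Fy => z /spec_leP; apply.
Qed.

End Specialization.

Lemma continuous_spec_leP (X Y : finTopologicalType) (f : X -> Y) :
  continuous f <-> {homo f : x y / x ⊑ y}.
Proof.
split=> [fc x y /spec_leP xy|fle y]; last first.
  by apply/cvg_spec_leP; apply: filterS (near_spec_le y) => x /fle.
apply: (xy (fun z => f z ⊑ f y)); apply/cvg_spec_leP; exact: fc.
Qed.

(* Maps from [A] to [B] are functions on all of [X], whose values outside [A]
   are irrelevant. *)
Section Fences.
Variables X Y : finTopologicalType.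
Implicit Types (A : {set X}) (B : {set Y}) (f g : X -> Y).

Definition poset_map A B f : Prop :=
  (forall x, x \in A -> f x \in B) /\ {in A &, {homo f : x y / x ⊑ y}}.

Definition fence_step A B f g : Prop :=
  [/\ poset_map A B f, poset_map A B g &
      (forall x, x \in A -> f x ⊑ g x) \/ (forall x, x \in A -> g x ⊑ f x)].

Definition fence A B := clos_refl_trans _ (fence_step A B).

Lemma fence_sym A B f g : fence A B f g -> fence A B g f.
Proof.
elim=> {f g} [f g [fm gm fg]|f|f g h _ gf _ hg]; first last.
- exact: rt_trans hg gf.
- exact: rt_refl.
by apply: rt_step; split=> //; case: fg; [right|left].
Qed.

End Fences.

Lemma poset_map_comp (X Y Z : finTopologicalType) (A : {set X}) (B : {set Y})
    (C : {set Z}) (f : X -> Y) (g : Y -> Z) :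
  poset_map A B f -> poset_map B C g -> poset_map A C (g \o f).
Proof.
move=> [fAB fle] [gBC gle]; split=> [x xA|x y xA yA xy] /=; first exact/gBC/fAB.
by apply: gle; [exact: fAB|exact: fAB|exact: fle].
Qed.

Lemma fence_comp (X' X Y Y' : finTopologicalType) (A' : {set X'}) (A : {set X})
    (B : {set Y}) (B' : {set Y'}) (p : X' -> X) (q : Y -> Y') (f g : X -> Y) :
  poset_map A' A p -> poset_map B B' q -> fence A B f g ->
  fence A' B' (q \o f \o p) (q \o g \o p).
Proof.
move=> pm qm; elim=> {f g} [f g [fm gm fg]|f|f g h _ gf _ hg].
- have [[[[pA _] [_ qle]] [fB _]] [gB _]] := (pm, qm, fm, gm).
  apply: rt_step; split.
  + exact: poset_map_comp pm (poset_map_comp fm qm).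
  + exact: poset_map_comp pm (poset_map_comp gm qm).
  + by case: fg => fg; [left|right]; move=> x /pA xA /=; apply: qle; auto.
- exact: rt_refl.
- exact: rt_trans gf hg.
Qed.

Definition fence_equivalent (X Y : finTopologicalType) (A : {set X})
    (B : {set Y}) : Prop :=
  exists (f : X -> Y) (g : Y -> X),
    [/\ poset_map A B f, poset_map B A g,
        fence A A (g \o f) id & fence B B (f \o g) id].

Lemma fence_equivalent_refl (X : finTopologicalType) (A : {set X}) :
  fence_equivalent A A.
Proof. by exists id, id; split; [split|split|exact: rt_refl|exact: rt_refl]. Qed.

Lemma fence_equivalent_sym (X Y : finTopologicalType) (A : {set X})
    (B : {set Y}) : fence_equivalent A B -> fence_equivalent B A.
Proof. by move=> [f [g [fm gm gf fg]]]; exists g, f. Qed.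

Lemma fence_equivalent_trans (Y X Z : finTopologicalType) (A : {set X})
    (B : {set Y}) (C : {set Z}) :
  fence_equivalent A B -> fence_equivalent B C -> fence_equivalent A C.
Proof.
move=> [f [g [fm gm gf fg]]] [h [k [hm km kh hk]]].
exists (h \o f), (g \o k); split.
- exact: poset_map_comp hm.
- exact: poset_map_comp gm.
- exact: rt_trans (fence_comp fm gm kh) gf.
- exact: rt_trans (fence_comp km hm fg) hk.
Qed.

(** One fence step joins [r] to the identity on [A]. On [B] they agree, and a further step absorbs
    their difference outside [B]. *)
Lemma fence_equivalent_retract (X : finTopologicalType) (A B : {set X})
    (r : X -> X) :
    B \subset A -> poset_map A B r -> {in B, forall x, r x = x} ->
    (forall x, x \in A -> x ⊑ r x) \/ (forall x, x \in A -> r x ⊑ x) ->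
  fence_equivalent A B.
Proof.
move=> /fintype.subsetP BA [rA rle] rB cmp.
exists r, id; split=> //; first by split=> // x /BA.
- apply: rt_step; split; [by split=> // x /rA/BA|by split|].
  by case: cmp; [right|left].
- apply: rt_step; split; [|by split|by left=> x /= /rB ->; exact: spec_le_refl].
  split=> [x /BA/rA //|x y xB yB] /=; by rewrite !rB.
Qed.

(** * Beat points and cores *)

Section Beats.
Variables (T : finType) (le : rel T) (A : {set T}).

(* For the specialization order these are the up beat points of [A], for the
   opposite order its down beat points. *)
Definition beat x y : Prop :=
  [/\ x \in A, y \in A, y != x, le x y
    & forall z, z \in A -> le x z -> z != x -> le y z].

Definition beat_retraction (x y z : T) : T := if z == x then y else z.

Hypothesis le_refl : reflexive le.
Hypothesis le_trans : transitive le.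

(** Only pairs involving [x] matter: what is strictly above [x] is above [y], and what is below [x]
    is below [y]. *)
Lemma beat_retraction_homo x y : beat x y ->
  {in A &, {homo beat_retraction x y : u v / le u v}}.
Proof.
move=> [xA yA yx xy ymin] u v uA vA uv; rewrite /beat_retraction.
have [ux|ux] := eqVneq u x; have [vx|vx] := eqVneq v x => //.
- by apply: ymin => //; rewrite -ux.
- by apply: le_trans xy; rewrite -vx.
Qed.

Lemma beat_comparable x y z : beat x y -> z \in A ->
  le x z || le z x -> le y z || le z y.
Proof.
move=> [xA yA yx xy ymin] zA /orP[xz|zx]; last by rewrite (le_trans zx xy) orbT.
by have [->|zx] := eqVneq z x; [rewrite xy orbT|rewrite ymin].
Qed.

(** If [f] moves a point, take a maximal moved point [z]. Every point of [A] strictly above [z] is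
    fixed, hence lies above [f z], which makes [z] a beat point. *)
Lemma no_beat_rigid (f : T -> T) : antisymmetric le ->
    (forall x y, ~ beat x y) ->
    (forall x, x \in A -> f x \in A) -> {in A &, {homo f : x y / le x y}} ->
    (forall x, x \in A -> le x (f x)) ->
  forall x, x \in A -> f x = x.
Proof.
move=> le_anti nbeat fA fle lef x xA; apply/eqP; apply: contraT => fx.
pose P z := (z \in A) && (f z != z).
have Px : P x by rewrite /P xA.
(* Maximality comes from minimising the number of points of [A] above [z]. *)
case: (@arg_minnP _ x P (fun z => #|[set u in A | le z u]|%SET) Px).
move=> z /andP[zA fz] zmin; case: (nbeat z (f z)); split; rewrite ?fA ?lef //.
move=> u uA zu uz.
have [fu|fu] := eqVneq (f u) u; first by rewrite -fu; exact: fle.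
(* A moved [u] strictly above [z] would have fewer points above it than [z]. *)
have := zmin u; rewrite /P uA fu => /(_ isT).
rewrite leqNgt proper_card //; apply/properP; split.
  apply/fintype.subsetP => v; rewrite !inE => /andP[-> uv] /=.
  exact: le_trans uv.
exists z; rewrite !inE ?zA ?le_refl //=.
by apply: contraNN uz => uz; apply/eqP/le_anti; rewrite uz.
Qed.

End Beats.

(** * Order complexes of subposets and reduction to cores *)

Section Chains.
Variable X : finTopologicalType.
Implicit Types A B C : {set X}.

Definition chains A : complex X := pullback id (order_complex X) A.

Lemma chainsP A s : reflect
  [/\ s != finset.set0, s \subset A & {in s &, forall x y, x ⊑ y || y ⊑ x}]
  (s \in simplices (chains A)).
Proof.
rewrite /= inE imset_id inE; apply: (iffP and3P) => -[].
  move=> sA s0 /forall_inP sC; split=> // x y xs ys.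
  by have /forall_inP := sC x xs; exact.
move=> s0 sA sC; split=> //.
by apply/forall_inP => x xs; apply/forall_inP => y; apply: sC.
Qed.

Lemma chainsT : chains [set: X]%SET = order_complex X.
Proof. by apply/val_inj/setP => s; rewrite /= inE finset.subsetT imset_id. Qed.

(** Such a [y] extends every chain through [x], so it dominates [x]. *)
Lemma chains_collapse A x y : x \in A -> y \in A -> y != x ->
    (forall z, z \in A -> x ⊑ z || z ⊑ x -> y ⊑ z || z ⊑ y) ->
  strong_collapse (chains A) (chains (A :\ x)%SET).
Proof.
move=> xA yA yx cmp.
rewrite /chains pullbackD1 -/(chains A).
apply: (@dominated_by_collapse _ _ _ y); split=> [||s] //.
  apply/chainsP; split; rewrite ?finset.sub1set //.
    by apply/set0Pn; exists x; rewrite set11.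
  by move=> u v /set1P-> /set1P->; rewrite spec_le_refl.
move=> /chainsP[s0 sA sC] xs; apply/chainsP; split.
- by apply/set0Pn; exists y; rewrite setU11.
- by rewrite finset.subUset finset.sub1set yA.
have ycmp z : z \in s -> y ⊑ z || z ⊑ y.
  by move=> zs; apply: cmp; [exact: (fintype.subsetP sA)|exact: sC].
move=> u v /setU1P[->|us] /setU1P[->|vs]; rewrite ?spec_le_refl ?ycmp //.
  by rewrite orbC ycmp.
exact: sC.
Qed.

Local Notation ge := (fun x y : X => y ⊑ x).

Definition core A : Prop :=
  (forall x y, ~ beat (@spec_le X) A x y) /\ (forall x y, ~ beat ge A x y).

(** A down beat point is an up beat point of the opposite order, which has the same chains. The
    retraction lies above the identity in one case and below it in the other. *)
Lemma beat_reduction A x y : beat (@spec_le X) A x y \/ beat ge A x y ->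
  fence_equivalent A (A :\ x)%SET /\
  strong_collapse (chains A) (chains (A :\ x)%SET).
Proof.
have le_tr := @spec_le_trans X.
have ge_refl : reflexive ge by exact: spec_le_refl.
have ge_tr : transitive ge by move=> u v w vu uw; exact: le_tr uw vu.
move=> xy; have [xA yA yx] : [/\ x \in A, y \in A & y != x] by case: xy => -[].
split; last first.
  apply: (chains_collapse xA yA yx) => z zA; case: xy => xy.
    exact: (beat_comparable le_tr xy zA).
  by rewrite orbC => /(beat_comparable ge_tr xy zA); rewrite orbC.
apply: (@fence_equivalent_retract _ _ _ (beat_retraction x y)).
- exact: finset.subsetDl.
- split; last first.
    case: xy => xy.
      exact: (beat_retraction_homo (@spec_le_refl X) le_tr xy).
    by move=> u v uA vA uv; apply: (beat_retraction_homo ge_refl ge_tr xy).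
  move=> z zA; rewrite /beat_retraction; case: eqP => [_|/eqP zx].
    by rewrite !inE yx.
  by rewrite !inE zx.
- by move=> z /setD1P[/negPf zx _]; rewrite /beat_retraction zx.
- rewrite /beat_retraction; case: xy => -[_ _ _ xy _]; [left|right]; move=> z zA;
  by case: eqP => [->|_] //; exact: spec_le_refl.
Qed.

Lemma exists_core A : exists C,
  [/\ core C, fence_equivalent A C & strong_collapse (chains A) (chains C)].
Proof.
have [n] := ubnP #|A|; elim: n A => // n IHn A ltAn.
have [coreA|ncore] := pselect (core A).
  by exists A; split=> //; [exact: fence_equivalent_refl|exact: rt_refl].
have [x [y xy]] : exists x y, beat (@spec_le X) A x y \/ beat ge A x y.
  apply: contrapT => nbeat; apply: ncore.
  by split=> x y xy; apply: nbeat; exists x, y; [left|right].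
have [eqA colA] := beat_reduction xy.
have [|C [coreC eqC colC]] := IHn (A :\ x)%SET.
  have xA : x \in A by case: xy => -[].
  by move: ltAn; rewrite (cardsD1 x A) xA ltnS.
exists C; split=> //; first exact: fence_equivalent_trans eqC.
exact: rt_trans colC.
Qed.

Hypothesis X0 : kolmogorov_space X.

(** Being the identity on [A] passes from a map of a fence to its neighbours: these are then
    comparable with the identity, hence rigid on a core. *)
Lemma core_fence_id A (f : X -> X) : core A -> fence A A f id ->
  forall x, x \in A -> f x = x.
Proof.
move=> [nup ndown] fid.
have le_anti : antisymmetric (@spec_le X).
  by move=> x y /andP[xy yx]; exact: spec_le_anti.
have rigid h : poset_map A A h ->
    (forall x, x \in A -> x ⊑ h x) \/ (forall x, x \in A -> h x ⊑ x) ->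
    forall x, x \in A -> h x = x.
  move=> [hA hle] [cmp|cmp].
    exact: (no_beat_rigid (@spec_le_refl X) (@spec_le_trans X)).
  apply: (@no_beat_rigid _ ge) => //; first exact: spec_le_refl.
  - by move=> u v w vu uw; exact: spec_le_trans uw vu.
  - by move=> u v /andP[uv vu]; apply: le_anti; rewrite vu.
  - by move=> u v uA vA uv; exact: hle.
have : forall g, fence A A f g ->
    (forall x, x \in A -> f x = x) <-> (forall x, x \in A -> g x = x).
  move=> g; elim=> {f fid g} [f g [fm gm fg]|f|f g h _ [fg gf] _ [gh hg]];
    [|exact: iff_refl|by split; auto].
  split=> fix_; apply: rigid => //.
    by case: fg => fg; [left|right]; move=> x xA; have := fg x xA; rewrite fix_.
  by case: fg => fg; [right|left]; move=> x xA; have := fg x xA; rewrite fix_.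
by move=> /(_ _ fid)[_]; apply.
Qed.

End Chains.

(** On cores the fences to [id] become equalities, so [f] and [g] are inverse isomorphisms of posets
    and carry chains to chains. *)
Lemma core_strong_deformation (X Y : finTopologicalType) (A : {set X})
    (B : {set Y}) :
    kolmogorov_space X -> kolmogorov_space Y -> core A -> core B ->
    fence_equivalent A B ->
  strong_deformation (relabel (inl : X -> X + Y) (chains A))
                     (relabel (inr : Y -> X + Y) (chains B)).
Proof.
move=> X0 Y0 cA cB [f [g [fm gm gf fg]]].
have chain_map (U V : finTopologicalType) (C : {set U}) (D : {set V}) h s :
    poset_map C D h -> s \in simplices (chains C) ->
    (h @: s)%SET \in simplices (chains D).
  move=> [hC hle] /chainsP[s0 /fintype.subsetP sC sch]; apply/chainsP; split.
  - by rewrite imset_eq0.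
  - by apply/fintype.subsetP => _ /imsetP[x /sC/hC ? ->].
  move=> _ _ /imsetP[x xs ->] /imsetP[y ys ->].
  by have /orP[xy|yx] := sch x y xs ys; apply/orP; [left|right]; apply: hle; auto.
have chain_vertex (U : finTopologicalType) (C : {set U}) x :
    x \in is_vertex (chains C) -> x \in C.
  by rewrite unfold_in => /chainsP[_]; rewrite finset.sub1set.
apply: (@iso_strong_deformation _ _ _ _ f g) => [s|s|x|x].
- exact: chain_map.
- exact: chain_map.
- by move=> /chain_vertex; exact: (core_fence_id X0 cA gf).
- by move=> /chain_vertex; exact: (core_fence_id Y0 cB fg).
Qed.

Lemma fence_same_strong_homotopy_type (X Y : finTopologicalType) :
    kolmogorov_space X -> kolmogorov_space Y ->
    fence_equivalent [set: X]%SET [set: Y]%SET ->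
  same_strong_homotopy_type (order_complex X) (order_complex Y).
Proof.
move=> X0 Y0 XY.
have [A [cA XA colA]] := exists_core [set: X]%SET.
have [B [cB YB colB]] := exists_core [set: Y]%SET.
have AB : fence_equivalent A B.
  apply: fence_equivalent_trans (fence_equivalent_sym XA) _.
  exact: fence_equivalent_trans XY YB.
exists (X + Y)%type, inl, inr; split; [by move=> ? ? []|by move=> ? ? []|].
rewrite -!chainsT.
apply: rt_trans (rt_trans _ _ _ _ _ (core_strong_deformation X0 Y0 cA cB AB) _).
  by apply: rt_step; left; apply: relabel_strong_collapse => // ? ? [].
by apply: rt_step; right; apply: relabel_strong_collapse => // ? ? [].
Qed.

Lemma poset_mapT (X Y : finTopologicalType) (f : X -> Y) :
  {homo f : x y / x ⊑ y} -> poset_map [set: X]%SET [set: Y]%SET f.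
Proof. by move=> fle; split=> [x _|x y _ _ /fle]; rewrite ?finset.in_setT. Qed.

Lemma fence_stepT (X Y : finTopologicalType) (f g : X -> Y) :
  {homo f : x y / x ⊑ y} -> {homo g : x y / x ⊑ y} ->
  (forall x, f x ⊑ g x) \/ (forall x, g x ⊑ f x) ->
  fence [set: X]%SET [set: Y]%SET f g.
Proof.
move=> fle gle cmp; apply: rt_step; split; [exact: poset_mapT|exact: poset_mapT|].
by case: cmp => cmp; [left|right] => x _.
Qed.

(** * Homotopies and fences *)

Section HomotopyFence.
Variables (R : realType) (X Y : finTopologicalType).
Implicit Types f g : X -> Y.
Local Open Scope classical_set_scope.
Local Open Scope ring_scope.

(* For [s] close to [t] a homotopy satisfies [H _ s ⊑ H _ t], so the times
   reached from [0] by a fence form a clopen subset of the unit interval. *)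
Lemma homotopic_fence f g :
  homotopic R f g -> fence [set: X]%SET [set: Y]%SET f g.
Proof.
move=> [H [Hc H0 H1]]; pose I : set R := [set` `[0, 1]].
have H_near x t : I t ->
    \forall p \near (x, t), I p.2 -> H p ⊑ H (x, t).
  move=> t01; have /subspace_continuousP/(_ (x, t)) := Hc.
  have xt : ([set: X] `*` I) (x, t) by split.
  move=> /(_ xt)/cvg_spec_leP; rewrite near_withinE.
  by apply: filterS => p pH p01; apply: pH; split.
have H_homo t : I t -> {homo (fun x => H (x, t)) : x y / x ⊑ y}.
  move=> t01 x y /spec_leP xy.
  (* [x] belongs to every neighbourhood of [y], hence [(x, t)] to every box around [(y, t)]. *)
  have [[P Q] /= [yP tQ] PQ] := H_near y t t01.
  by apply: (PQ (x, t)) => //; split; [exact: xy|exact: nbhs_singleton].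
have H_le t : I t ->
    \forall s \near t, I s -> forall x, H (x, s) ⊑ H (x, t).
  move=> t01.
  have : \forall s \near t, forall x, I s -> H (x, s) ⊑ H (x, t).
    (* Finiteness of [X] gives one neighbourhood of [t] that serves all [x]. *)
    apply: (@filter_forall _ X _ (nbhs t) (nbhs_filter t)) => x.
    have [[P Q] /= [xP tQ] PQ] := H_near x t t01.
    apply: filterS tQ => s sQ; apply: (PQ (x, s)); split=> //.
    exact: nbhs_singleton xP.
  by apply: filterS => s sH s01 x; apply: sH.
pose reached t :=
  fence [set: X]%SET [set: Y]%SET (fun x => H (x, 0)) (fun x => H (x, t)).
have H_step s t : I s -> I t -> (forall x, H (x, s) ⊑ H (x, t)) ->
    reached s <-> reached t.
  move=> s01 t01 st.
  have fst :
    fence [set: X]%SET [set: Y]%SET (fun x => H (x, s)) (fun x => H (x, t)).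
    by apply: fence_stepT; [exact: H_homo|exact: H_homo|left].
  by split=> ?; [apply: rt_trans fst|apply: rt_trans (fence_sym fst)].
have i0 : I (0 : R) by rewrite /I /= in_itv /= lexx ler01.
have i1 : I (1 : R) by rewrite /I /= in_itv /= lexx ler01.
have E : [set t | I t /\ reached t] = I.
  apply: segment_connected; first by exists 0; split=> //; exact: rt_refl.
    (* Relative openness: the implication holds trivially outside [I], so the interior can be taken
       in the whole line. *)
    exists [set t | I t -> reached t]°; first exact: open_interior.
    apply/seteqP; split=> t [t01 tr]; split=> //.
      apply: filterS (H_le t t01) => s ts s01.
      by apply/(H_step s t s01 t01 (ts s01)).
    exact: (interior_subset tr).
  (* Relative closedness: near an unreached time all times of [I] are unreached. *)
  exists (~` [set t | I t -> ~ reached t]°).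
    exact/open_closedC/open_interior.
  apply/seteqP; split=> t [t01 tr]; split=> //.
    by move=> /interior_subset; apply.
  apply: contrapT => ntr; apply: tr.
  by apply: filterS (H_le t t01) => s ts s01 /(H_step s t s01 t01 (ts s01)).
have -> : f = fun x => H (x, 0) by apply/funext => x; rewrite H0.
have -> : g = fun x => H (x, 1) by apply/funext => x; rewrite H1.
by have [] : [set t | I t /\ reached t] 1 by rewrite E.
Qed.

(* A homotopy over the whole line, stationary outside [[0, n]]: homotopies of
   this form are easy to concatenate. *)
Definition line_homotopic (n : nat) f g : Prop :=
  exists H : X * R -> Y,
    [/\ continuous H, forall x t, t <= 0 -> H (x, t) = f x
      & forall x t, n%:R <= t -> H (x, t) = g x].

Lemma line_homotopic_step n h f g :
    {homo f : x y / x ⊑ y} -> {homo g : x y / x ⊑ y} ->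
    (forall x, f x ⊑ g x) \/ (forall x, g x ⊑ f x) ->
  line_homotopic n h f -> line_homotopic n.+1 h g.
Proof.
move=> fle gle cmp [H [Hc H0 Hn]].
pose b := `[< forall x, f x ⊑ g x >].
(* The switch at [n + 1/2] comes after [H] has settled at [f] and before [n + 1]. The strict
   inequality selects [g] at the switch, the weak one [f]. *)
pose before (t : R) := if b then t < n.+1%:R - 2^-1 else t <= n.+1%:R - 2^-1.
have c_n : n%:R < n.+1%:R - 2^-1 :> R.
  by rewrite -natr1 -addrA ltrDl subr_gt0 invf_lt1 ?ltr1n.
have c_n1 : n.+1%:R - 2^-1 < n.+1%:R :> R by rewrite gtrBl invr_gt0.
set c := n.+1%:R - 2^-1 in before c_n c_n1.
have lt_before t : t < c -> before t by rewrite /before; case: ifP => // _ /ltW.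
have gt_before t : c < t -> before t = false.
  by move=> ct; rewrite /before ltNge (ltW ct) leNgt ct if_same.
exists (fun p => if before p.2 then H p else g p.1).
split=> [[x t]|x t t0|x t nt] /=.
- apply/cvg_spec_leP; have near1 : \forall p \near (x, t), p.1 ⊑ x.
    exact: (cvg_fst (near_spec_le x)).
  have near2 (P : R -> Prop) :
      (\forall s \near t, P s) -> \forall p \near (x, t), P p.2.
    by move=> Pt; exact: (cvg_snd Pt).
  have [tc|ct|tc] := ltgtP t c.
  + rewrite lt_before //; have /near2 := lt_nbhsl tc.
    have /cvg_spec_leP := Hc (x, t); apply: filterS2 => p pH pc.
    by rewrite lt_before.
  + rewrite gt_before //; have /near2 := lt_nbhsr ct.
    by apply: filterS2 near1 => p px cp /=; rewrite gt_before // gle.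
  (* Around the switch [H] already equals [f], so only [f] and [g] are compared. *)
  + have /near2 : \forall s \near t, n%:R < s by apply: lt_nbhsr; rewrite tc.
    have cn : n%:R <= t by rewrite tc ltW.
    apply: filterS2 near1 => -[y s] /= yx ns.
    rewrite !Hn // ?ltW // /before /b tc.
    case: (asboolP (forall x, f x ⊑ g x)) => fg; rewrite ?ltxx ?lexx.
      by case: ifP => _; [apply: spec_le_trans (fg _) _|]; exact: gle.
    case: cmp => // gf.
    by case: ifP => _; [|apply: spec_le_trans (gf _) _]; exact: fle.
- by rewrite lt_before ?H0 // (le_lt_trans t0) // (le_lt_trans _ c_n).
- by rewrite gt_before // (lt_le_trans c_n1).
Qed.

(** Each fence step lengthens a line homotopy by one unit of time. An empty fence carries no
    monotonicity, so the constant homotopy rests on the continuity of [f]. *)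
Lemma fence_homotopic f g : continuous f ->
  fence [set: X]%SET [set: Y]%SET f g -> homotopic R f g.
Proof.
move=> /continuous_spec_leP fle fg.
have [n [H [Hc H0 H1]]] : exists n, line_homotopic n f g.
  have : exists n, line_homotopic n f f.
    exists 0%N, (f \o fst); split=> // -[x t]; apply/cvg_spec_leP.
    have px : \forall p \near (x, t), p.1 ⊑ x.
      exact: (cvg_fst (near_spec_le x)).
    by apply: filterS px => p /fle.
  (* The starting map is separated from the current end, so that the induction can concatenate
     fences. *)
  move: {1 3}f => h.
  elim: fg h => {f g fle} [f g [[_ fle] [_ gle] cmp] h [n hf]||].
  - exists n.+1; apply: line_homotopic_step hf.
    + by move=> x y; apply: fle; rewrite finset.in_setT.
    + by move=> x y; apply: gle; rewrite finset.in_setT.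
    + by case: cmp => cmp; [left|right] => x; apply: cmp; rewrite finset.in_setT.
  - by [].
  - by move=> f g k _ IHg _ IHk h /IHg/IHk.
(* Time [[0, 1]] is stretched onto [[0, n]]; for [n = 0] the homotopy is constant and [f = g]. *)
exists (fun p => H (p.1, p.2 * n%:R)); split=> [|x|x].
- apply: continuous_subspaceT => -[x t].
  have rescale : (fun p : X * R => (p.1, p.2 * n%:R)) @ (x, t) --> (x, t * n%:R).
    apply: (@cvg_pair _ _ _ (nbhs (x, t)) (nbhs x) (nbhs (t * n%:R))).
      exact: cvg_fst.
    by apply: cvgM; [exact: cvg_snd|exact: cvg_cst].
  exact: (cvg_comp _ _ rescale (Hc (x, t * n%:R))).
- by rewrite H0 // mul0r.
- by rewrite H1 // mul1r.
Qed.

End HomotopyFence.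

Section HomotopyEquivalence.
Variables (R : realType) (X Y : finTopologicalType).

Lemma homotopy_fence_equivalent :
  homotopy_equivalent R X Y -> fence_equivalent [set: X]%SET [set: Y]%SET.
Proof.
move=> [f [g [/continuous_spec_leP fle /continuous_spec_leP gle gf fg]]].
exists f, g; split;
  [exact: poset_mapT|exact: poset_mapT| |].
- exact: homotopic_fence gf.
- exact: homotopic_fence fg.
Qed.

Lemma fence_homotopy_equivalent :
  fence_equivalent [set: X]%SET [set: Y]%SET -> homotopy_equivalent R X Y.
Proof.
move=> [f [g [[_ fm] [_ gm] gf fg]]].
have fc : continuous f.
  by apply/continuous_spec_leP => x y; apply: fm; rewrite finset.in_setT.
have gc : continuous g.
  by apply/continuous_spec_leP => x y; apply: gm; rewrite finset.in_setT.
exists f, g; split=> //; apply: fence_homotopic => // x.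
- by apply: continuous_comp; [exact: fc|exact: gc].
- by apply: continuous_comp; [exact: gc|exact: fc].
Qed.

End HomotopyEquivalence.

(** * Face posets *)

Section FaceMaps.
Variables (T W : finType) (K : complex T) (L : complex W).
Variable F : {set T} -> {set W}.
Hypothesis FKL : forall s : {set T}, s \in simplices K -> F s \in simplices L.

Definition face_map (s : face_space K) : face_space L :=
  exist _ (F (val s)) (FKL (valP s)).

Lemma face_map_homo :
  {homo F : s t / s \subset t} -> {homo face_map : s t / s ⊑ t}.
Proof. by move=> Fle s t; rewrite !spec_leE; exact: Fle. Qed.

End FaceMaps.

Lemma elementary_collapse_fence (T : finType) (K L : complex T) :
  elementary_strong_collapse K L ->
  fence_equivalent [set: face_space K]%SET [set: face_space L]%SET.
Proof.
move=> [v [/dominatedP[a [Kv av aK]] ->]].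
pose r (s : {set T}) := if v \in s then (a |: s :\ v)%SET else s.
pose h (s : {set T}) := if v \in s then (a |: s)%SET else s.
have hK s : s \in simplices K -> h s \in simplices K.
  by rewrite /h; case: ifP => // vs sK; exact: aK.
have rh s : r s \subset h s.
  rewrite /r /h; case: ifP => // _.
  by apply: finset.setUS; exact: finset.subsetDl.
have rK s : s \in simplices K -> r s \in simplices (deletion K v).
  move=> sK; rewrite inE; apply/andP; split.
    apply: (complexS (hK s sK) (rh s)); rewrite /r; case: ifP => _.
      by apply/set0Pn; exists a; rewrite setU11.
    by apply: contraTneq sK => ->; exact: complex0.
  rewrite /r; case: ifPn => // _.
  by rewrite !inE eqxx (eq_sym v) (negPf av).
have iK s : s \in simplices (deletion K v) -> id s \in simplices K.
  by rewrite inE => /andP[].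
have h_homo : {homo h : s t / s \subset t}.
  move=> s t st; rewrite /h; case: ifPn => vs; case: ifPn => vt.
  - exact: finset.setUS.
  - by rewrite (fintype.subsetP st _ vs) in vt.
  - exact/(fintype.subset_trans st)/finset.subsetUr.
  - exact: st.
have r_homo : {homo r : s t / s \subset t}.
  move=> s t st; rewrite /r; case: ifPn => vs; case: ifPn => vt.
  - exact/finset.setUS/finset.setSD.
  - by rewrite (fintype.subsetP st _ vs) in vt.
  (* Here [s] misses [v], so it is contained in [t :\ v]. *)
  - by apply: fintype.subset_trans (finset.subsetUr _ _); rewrite subsetD1 st.
  - exact: st.
have rm := face_map_homo rK r_homo.
have im := face_map_homo iK (fun s t st => st).
have hm := face_map_homo hK h_homo.
have irm : {homo face_map iK \o face_map rK : s t / s ⊑ t} by move=> s t /rm/im.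
have rim : {homo face_map rK \o face_map iK : s t / s ⊑ t} by move=> s t /im/rm.
exists (face_map rK), (face_map iK); split;
  [exact: poset_mapT|exact: poset_mapT| |].
  (* Both [r s] and [s] are contained in [h s]. *)
  apply: (@rt_trans _ _ _ (face_map hK)); apply: fence_stepT => //.
    by left=> s; rewrite spec_leE; exact: rh.
  right=> s; rewrite spec_leE /face_le /= /h.
  by case: ifP => // _; exact: finset.subsetUr.
apply: fence_stepT => //; left=> s; rewrite spec_leE /face_le /= /r.
have : val s \in simplices (deletion K v) by exact: valP.
by rewrite inE => /andP[_ /negPf->].
Qed.

Lemma strong_deformation_fence (T : finType) (K L : complex T) :
  strong_deformation K L ->
  fence_equivalent [set: face_space K]%SET [set: face_space L]%SET.
Proof.
have collapse M N : strong_collapse M N ->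
    fence_equivalent [set: @face_space T M]%SET [set: @face_space T N]%SET.
  elim=> {M N} [M N /elementary_collapse_fence//|M|M N P _ MN _ NP].
    exact: fence_equivalent_refl.
  exact: fence_equivalent_trans MN NP.
elim=> {K L} [M N [/collapse//|/collapse NM]|M|M N P _ MN _ NP].
- exact: fence_equivalent_sym.
- exact: fence_equivalent_refl.
- exact: fence_equivalent_trans MN NP.
Qed.

(** Image and preimage under [i] are inverse isomorphisms of face posets, so each fence is a single
    step between equal maps. *)
Lemma relabel_fence (T W : finType) (i : T -> W) (K : complex T) : injective i ->
  fence_equivalent [set: face_space K]%SET [set: face_space (relabel i K)]%SET.
Proof.
move=> i_inj.
have iK s : s \in simplices K -> (i @: s)%SET \in simplices (relabel i K).
  exact: imset_f.
have imK (s : {set T}) : (i @^-1: (i @: s) = s)%SET.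
  by apply/setP => x; rewrite inE mem_imset.
have jK t : t \in simplices (relabel i K) -> (i @^-1: t)%SET \in simplices K.
  by case/imsetP=> s sK ->; rewrite imK.
have im := face_map_homo iK (@imsetS _ _ i).
have jm := face_map_homo jK (@finset.preimsetS _ _ i).
have jim : {homo face_map jK \o face_map iK : s t / s ⊑ t} by move=> s t /im/jm.
have ijm : {homo face_map iK \o face_map jK : s t / s ⊑ t} by move=> s t /jm/im.
exists (face_map iK), (face_map jK); split;
  [exact: poset_mapT|exact: poset_mapT| |].
  by apply: fence_stepT => //; left=> s; rewrite spec_leE /face_le /= imK.
apply: fence_stepT => //; left=> t; rewrite spec_leE /face_le /=.
have /imsetP[s sK ->] : val t \in simplices (relabel i K) by exact: valP.
by rewrite imK.
Qed.

Theorem theorem4p13 :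
  (forall (R : realType) (X Y : finTopologicalType),
     kolmogorov_space X -> kolmogorov_space Y ->
     homotopy_equivalent R X Y ->
     same_strong_homotopy_type (order_complex X) (order_complex Y))
  /\
  (forall (R : realType) (T S : finType) (K : complex T) (L : complex S),
     same_strong_homotopy_type K L ->
     homotopy_equivalent R (face_space K) (face_space L)).
Proof.
split=> [R X Y X0 Y0 /homotopy_fence_equivalent XY|R T S K L].
  exact: fence_same_strong_homotopy_type.
move=> [W [i [j [ii ji KL]]]]; apply: fence_homotopy_equivalent.
(* The deformation runs over [W]; relabelling at both ends leaves the face posets unchanged up to
   isomorphism. *)
apply: fence_equivalent_trans (relabel_fence K ii) _.
apply: fence_equivalent_trans (fence_equivalent_sym (relabel_fence L ji)).
exact: strong_deformation_fence.
Qed.
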